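(* Let $\kappa:\mathbb{R}^n\to\mathbb{R}\cup\{+\infty\}$ and $\rho:\mathbb{R}^m\to\mathbb{R}\cup\{+\infty\}$ be closed gauges, $A:\mathbb{R}^n\to\mathbb{R}^m$ linear, $b\in\mathbb{R}^m$, $\sigma\ge0$, with $\rho(b)>\sigma$. Suppose that the gauge primal $(G_p)$ and the gauge dual $(G_d)$ are each relatively strictly feasible. If $y^*$ is optimal for $(G_d)$, then for any primal feasible $x$ the following conditions are equivalent: (a) $x$ is optimal for $(G_p)$; (b) $\langle x,A^Ty^*\rangle=\kappa(x)\cdot\kappa^\circ(A^Ty^* )$ and $b-Ax\in\partial(\sigma\rho^\circ)(y^* )$; (c) $A^Ty^*\in\kappa^\circ(A^Ty^* )\cdot\partial\kappa(x)$ and $b-Ax\in\partial(\sigma\rho^\circ)(y^* )$, where, by convention, $\sigma\rho^\circ=\delta_{\operatorname{cl}\operatorname{dom}\rho^\circ}$ when $\sigma=0$.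
   Context: A gauge is a convex function into $\mathbb{R}\cup\{+\infty\}$ that is nonnegative, positively homogeneous, and vanishes at the origin; closed means lower semicontinuous. The polar of a gauge $\kappa$ is $\kappa^\circ(y)=\inf\{\mu>0\mid\langle x,y\rangle\le\mu\kappa(x)\ \forall x\}$ (with $\inf\emptyset=+\infty$). $\operatorname{dom}h=\{h<+\infty\}$, $\partial$ is the convex subdifferential, and $\delta_C$ is the $0/{+\infty}$ indicator of $C$. Problems: $(G_p)$: minimize $\kappa(x)$ subject to $\rho(b-Ax)\le\sigma$. $(G_d)$: minimize $\kappa^\circ(A^Ty)$ subject to $\langle b,y\rangle-\sigma\rho^\circ(y)\ge1$ (same convention for $\sigma=0$). Feasible sets: $\mathcal{F}_p=\{u\mid\rho(b-u)\le\sigma\}$, $\mathcal{F}_d=\{y\mid\langle b,y\rangle-\sigma\rho^\circ(y)\ge1\}$. $x$ is primal feasible if $x\in\operatorname{dom}\kappa$ and $Ax\in\mathcal{F}_p$. $(G_p)$ is relatively strictly feasible if $A^{-1}(\operatorname{ri}\mathcal{F}_p)\cap\operatorname{ri}\operatorname{dom}\kappa\neq\emptyset$; $(G_d)$ is relatively strictly feasible if $A^T(\operatorname{ri}\mathcal{F}_d)\cap\operatorname{ri}\operatorname{dom}\kappa^\circ\ne\emptyset$. *)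

(* Defs.v *)
(* R^n is 'cV[R]_n, and linear maps R^n -> R^m are matrices
   acting by A *m x, so that the adjoint is A^T. *)
From mathcomp Require Import all_boot all_order all_algebra.
From mathcomp Require Import all_classical all_reals ereal topology normedtype.

Set Implicit Arguments.
Unset Strict Implicit.
Unset Printing Implicit Defensive.

Import Order.TTheory GRing.Theory Num.Theory.
Import numFieldNormedType.Exports.

Local Open Scope classical_set_scope.
Local Open Scope ring_scope.

Definition dotv (R : realType) (n : nat) (x y : 'cV[R]_n) : R :=
  (x^T *m y) ord0 ord0.

Definition edom (R : realType) (n : nat) (h : 'cV[R]_n -> \bar R) :
    set 'cV[R]_n :=
  [set x | (h x < +oo)%E].

Definition econvex (R : realType) (n : nat) (h : 'cV[R]_n -> \bar R) : Prop :=
  forall (t : R) (x y : 'cV[R]_n), 0 <= t <= 1 ->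
    (h ((1 - t) *: x + t *: y)%R <= (1 - t)%:E * h x + t%:E * h y)%E.

Record gauge (R : realType) (n : nat) (h : 'cV[R]_n -> \bar R) : Prop := {
  gauge_convex : econvex h;
  gauge_ge0 : forall x, (0 <= h x)%E;
  gauge_homog : forall (t : R) x, 0 < t -> h (t *: x) = (t%:E * h x)%E;
  gauge0 : h 0 = 0%E }.

Definition closed_gauge (R : realType) (n : nat) (h : 'cV[R]_n -> \bar R) :
    Prop :=
  gauge h /\ lower_semicontinuous h.

(* The infimum is taken in \bar R, where ereal_inf set0 = +oo. *)
Definition polar (R : realType) (n : nat) (h : 'cV[R]_n -> \bar R)
    (y : 'cV[R]_n) : \bar R :=
  ereal_inf [set mu%:E | mu in [set mu : R |
    0 < mu /\ forall x, ((dotv x y)%:E <= mu%:E * h x)%E]].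

Definition indicator_fun (R : realType) (n : nat) (C : set 'cV[R]_n)
    (x : 'cV[R]_n) : \bar R :=
  if x \in C then 0%E else +oo%E.

(* The multiple sigma h, with the convention that 0 h is the indicator of
   cl (dom h) rather than the pointwise product. *)
Definition scale_fun (R : realType) (n : nat) (sigma : R)
    (h : 'cV[R]_n -> \bar R) (y : 'cV[R]_n) : \bar R :=
  if sigma == 0 then indicator_fun (closure (edom h)) y
  else (sigma%:E * h y)%E.

Definition subdiff (R : realType) (n : nat) (h : 'cV[R]_n -> \bar R)
    (x : 'cV[R]_n) : set 'cV[R]_n :=
  [set v | forall z, (h x + (dotv v (z - x)%R)%:E <= h z)%E].

(* The set c . S; it is only meaningful for finite c, and taken to be empty
   when c is infinite. *)
Definition scale_set (R : realType) (n : nat) (c : \bar R)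
    (S : set 'cV[R]_n) : set 'cV[R]_n :=
  [set u | exists2 r : R, c = r%:E & exists2 v, S v & u = r *: v].

Definition affine_set (R : realType) (n : nat) (M : set 'cV[R]_n) : Prop :=
  forall (t : R) x y, M x -> M y -> M ((1 - t) *: x + t *: y).

Definition affine_hull (R : realType) (n : nat) (C : set 'cV[R]_n) :
    set 'cV[R]_n :=
  \bigcap_(M in [set M | affine_set M /\ C `<=` M]) M.

Definition relint (R : realType) (n : nat) (C : set 'cV[R]_n) :
    set 'cV[R]_n :=
  [set x | C x /\ \forall z \near x, affine_hull C z -> C z].

Definition is_minimizer (R : realType) (n : nat) (f : 'cV[R]_n -> \bar R)
    (C : set 'cV[R]_n) (x : 'cV[R]_n) : Prop :=
  C x /\ forall z, C z -> (f x <= f z)%E.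

Section GaugeDuality.
Variables (R : realType) (m n : nat).
Variables (kappa : 'cV[R]_n -> \bar R) (rho : 'cV[R]_m -> \bar R).
Variables (A : 'M[R]_(m, n)) (b : 'cV[R]_m) (sigma : R).

Definition Fp : set 'cV[R]_m := [set u | (rho (b - u)%R <= sigma%:E)%E].

Definition Fd : set 'cV[R]_m :=
  [set y | (1 <= (dotv b y)%:E - scale_fun sigma (polar rho) y)%E].

Definition primal_feasible : set 'cV[R]_n :=
  [set x | edom kappa x /\ Fp (A *m x)].

Definition dual_feasible : set 'cV[R]_m :=
  [set y | edom (polar kappa) (A^T *m y) /\ Fd y].

Definition primal_optimal : 'cV[R]_n -> Prop :=
  is_minimizer kappa primal_feasible.

Definition dual_optimal : 'cV[R]_m -> Prop :=
  is_minimizer (fun y => polar kappa (A^T *m y)) dual_feasible.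

Definition primal_rel_strictly_feasible : Prop :=
  mulmx A @^-1` relint Fp `&` relint (edom kappa) !=set0.

Definition dual_rel_strictly_feasible : Prop :=
  mulmx A^T @` relint Fd `&` relint (edom (polar kappa)) !=set0.

End GaugeDuality.

(* Main.v *)
(* Weak duality reads 1 <= <x, A^T y> <= kappa(x) kappa^o(A^T y): indeed y is
   dual feasible exactly when <u, y> >= 1 on F_p, because sigma rho^o is the
   support function of {rho <= sigma}. For sigma = 0 this says that cl dom rho^o
   is the polar cone of {rho = 0}; a point y of that cone satisfies
   <w, y> <= mu rho(w) + e |w| for some mu, by compactness of the unit sphere
   and lower semicontinuity, and splitting this bound moves y by at most e into
   dom rho^o. Conditions (b) and (c) then amount to equality throughout the
   chain, and it remains to see that a primal optimum x admits a dual feasible y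
   with kappa(x) kappa^o(A^T y) <= 1. Both this multiplier and the splitting come
   from one algebraic form of Hahn-Banach: a sublinear function on a linear
   subspace has a linear minorant. The relative interior condition is used only
   to know that the directions c (A z - u), with c > 0, z in dom kappa and u in
   F_p, form a linear subspace. *)
Require Import Defs.
From mathcomp Require Import all_boot all_order all_algebra.
From mathcomp Require Import ring lra.
From mathcomp Require Import all_classical all_reals ereal topology normedtype.

Set Implicit Arguments.
Unset Strict Implicit.
Unset Printing Implicit Defensive.

Import Order.TTheory GRing.Theory Num.Theory.
Import numFieldNormedType.Exports.

Local Open Scope classical_set_scope.
Local Open Scope ring_scope.

(** * Inner product and linear minorants of cones *)

Lemma dotvE (R : realType) n (x y : 'cV[R]_n) :
  dotv x y = \sum_i x i ord0 * y i ord0.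
Proof. by rewrite /dotv mxE; apply: eq_bigr => i _; rewrite mxE. Qed.

Lemma dotvC (R : realType) n (x y : 'cV[R]_n) : dotv x y = dotv y x.
Proof. by rewrite !dotvE; apply: eq_bigr => i _; rewrite mulrC. Qed.

Lemma dotvDr (R : realType) n (x y z : 'cV[R]_n) :
  dotv x (y + z) = dotv x y + dotv x z.
Proof. by rewrite /dotv mulmxDr mxE. Qed.

Lemma dotvZr (R : realType) n c (x y : 'cV[R]_n) :
  dotv x (c *: y) = c * dotv x y.
Proof. by rewrite /dotv -scalemxAr mxE. Qed.

Lemma dotvNr (R : realType) n (x y : 'cV[R]_n) : dotv x (- y) = - dotv x y.
Proof. by rewrite /dotv mulmxN mxE. Qed.

Lemma dotv0r (R : realType) n (x : 'cV[R]_n) : dotv x 0 = 0.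
Proof. by rewrite /dotv mulmx0 mxE. Qed.

Lemma dotvDl (R : realType) n (x y z : 'cV[R]_n) :
  dotv (y + z) x = dotv y x + dotv z x.
Proof. by rewrite !(dotvC _ x) dotvDr. Qed.

Lemma dotvZl (R : realType) n c (x y : 'cV[R]_n) :
  dotv (c *: x) y = c * dotv x y.
Proof. by rewrite !(dotvC _ y) dotvZr. Qed.

Lemma dotvNl (R : realType) n (x y : 'cV[R]_n) : dotv (- x) y = - dotv x y.
Proof. by rewrite !(dotvC _ y) dotvNr. Qed.

Lemma dotv0l (R : realType) n (x : 'cV[R]_n) : dotv 0 x = 0.
Proof. by rewrite dotvC dotv0r. Qed.

Lemma dotv_trmx (R : realType) m n (A : 'M[R]_(m, n)) x y :
  dotv x (A^T *m y) = dotv (A *m x) y.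
Proof. by rewrite /dotv trmx_mul mulmxA. Qed.

Definition dotv_lin :=
  (dotvDr, dotvDl, dotvNr, dotvNl, dotvZr, dotvZl, dotv0r, dotv0l).

Lemma dotv_delta (R : realType) n (i : 'I_n) (w : 'cV[R]_n) :
  dotv (delta_mx i ord0) w = w i ord0.
Proof.
rewrite dotvE (bigD1 i) //= mxE !eqxx mul1r big1 ?addr0 // => j ji.
by rewrite mxE (negbTE ji) mul0r.
Qed.

(* A convex cone K in R^m x R is read as the epigraph of a sublinear function
   on a linear subspace. The coordinates of the linear minorant are chosen one
   at a time; the first k coordinates form the space on which the minorant is
   known to lie below K. *)
Lemma cone_linear_minorant (R : realType) m (K : 'cV[R]_m -> R -> Prop) :
  (forall w1 t1 w2 t2, K w1 t1 -> K w2 t2 -> K (w1 + w2) (t1 + t2)) ->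
  (forall c w t, 0 < c -> K w t -> K (c *: w) (c * t)) ->
  (forall t, K 0 t -> 0 <= t) ->
  (forall w t, K w t -> exists t', K (- w) t') ->
  exists y, forall w t, K w t -> dotv y w <= t.
Proof.
move=> KD KZ K0 KN.
suff H k : exists y, forall w t, K w t ->
    (forall i : 'I_m, (k <= i)%N -> w i ord0 = 0) -> dotv y w <= t.
  have [y Hy] := H m; exists y => w t Kwt; apply: Hy => // i.
  by rewrite leqNgt ltn_ord.
elim: k => [|k [y Hy]].
  exists 0 => w t Kwt w0; rewrite dotv0l.
  have w_eq0 : w = 0 by apply/colP => i; rewrite w0 // mxE.
  by apply: K0; rewrite -w_eq0.
have [mk|km] := leqP m k.
  exists y => w t Kwt _; apply: (Hy _ _ Kwt) => i /(leq_trans mk).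
  by rewrite leqNgt ltn_ord.
pose i0 := Ordinal km.
pose D w t := K w t /\ forall i : 'I_m, (k < i)%N -> w i ord0 = 0.
(* The new coefficient [c] must satisfy [dotv y w + c * w i0 ord0 <= t]: [slope] is a lower bound on
   [c] where that coordinate is negative, an upper bound where it is positive. *)
pose slope w t := (t - dotv y w) / w i0 ord0.
have cross w1 t1 w2 t2 : D w1 t1 -> D w2 t2 ->
    w1 i0 ord0 < 0 -> 0 < w2 i0 ord0 -> slope w1 t1 <= slope w2 t2.
  move=> [K1 z1] [K2 z2] n1 p2; rewrite /slope.
  set a1 := w1 i0 ord0 in n1 *; set a2 := w2 i0 ord0 in p2 *.
  have na1 : 0 < - a1 by rewrite oppr_gt0.
  (* The combination [a2 *: w1 - a1 *: w2] has zero coordinate [i0], so the induction hypothesis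
     applies to it. *)
  have := Hy _ _ (KD _ _ _ _ (KZ _ _ _ p2 K1) (KZ _ _ _ na1 K2)).
  rewrite !dotv_lin => /(_ _) hh.
  have {}hh : a2 * dotv y w1 + - a1 * dotv y w2 <= a2 * t1 + - a1 * t2.
    apply: hh => i ki; rewrite !mxE.
    have [ik|] := eqVneq (i : nat) k.
      have -> : i = i0 by apply: val_inj.
      by rewrite -/a1 -/a2; ring.
    rewrite neq_ltn ltnNge ki /= => {}ki.
    by rewrite z1 // z2 // !mulr0 addr0.
  rewrite ler_pdivlMr // mulrAC ler_ndivrMr //; lra.
have [c Hc] : exists c, forall w t, D w t ->
    (w i0 ord0 < 0 -> slope w t <= c) /\ (0 < w i0 ord0 -> c <= slope w t).
  have [[w1 [t1 [D1 n1]]]|none] :=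
      pselect (exists w t, D w t /\ w i0 ord0 < 0); last first.
    (* By [KN], a positive coordinate would yield a negative one at [- w]; all coordinates [i0]
       vanish and any [c] works. *)
    exists 0 => w t Dw; split=> [wn|wp]; first by case: none; exists w, t.
    have [t' K'] := KN _ _ Dw.1.
    case: none; exists (- w), t'; rewrite mxE oppr_lt0; split=> //.
    by split=> // i ki; rewrite mxE Dw.2 // oppr0.
  have [t2 K2] := KN _ _ D1.1.
  have D2 : D (- w1) t2.
    by split=> // i ki; rewrite mxE D1.2 // oppr0.
  have p2 : 0 < (- w1) i0 ord0 by rewrite mxE oppr_gt0.
  pose S := [set s | exists w t, [/\ D w t, w i0 ord0 < 0 & s = slope w t]].
  have Sub w t : D w t -> 0 < w i0 ord0 -> ubound S (slope w t).
    by move=> Dw wp _ [w' [t' [D' n' ->]]]; exact: cross.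
  exists (sup S) => w t Dw; split=> [wn|wp].
    by apply: ub_le_sup; [exists (slope (- w1) t2); exact: Sub|exists w, t].
  by apply: ge_sup; [exists (slope w1 t1), w1, t1|exact: Sub].
exists (y + c *: delta_mx i0 ord0) => w t Kw zw.
have [cn cp] := Hc _ _ (conj Kw zw).
rewrite !dotv_lin dotv_delta.
have [wn|wp|w0] := ltgtP (w i0 ord0) 0.
- by move: (cn wn); rewrite /slope ler_ndivrMr // => ?; lra.
- by move: (cp wp); rewrite /slope ler_pdivlMr // => ?; lra.
rewrite w0 mulr0 addr0; apply: Hy => // i.
rewrite leq_eqVlt => /orP[/eqP ik|]; last exact: zw.
by have -> : i = i0 by apply: val_inj.
Qed.

(* lra fails on a context containing equations in \bar R. *)
Ltac rlra :=
  repeat match goal with H : @eq (\bar _) _ _ |- _ => clear H end; lra.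

(** * Gauges and their polars *)

Lemma gauge_finite (R : realType) n (h : 'cV[R]_n -> \bar R) x :
  gauge h -> edom h x -> exists2 s : R, 0 <= s & h x = s%:E.
Proof.
move=> /gauge_ge0 /(_ x); rewrite /edom /=.
by case: (h x) => [s||] //; rewrite lee_fin => s0 _; exists s.
Qed.

Lemma gauge_ge0_fin (R : realType) n (h : 'cV[R]_n -> \bar R) x (s : R) :
  gauge h -> h x = s%:E -> 0 <= s.
Proof. by move=> /gauge_ge0 /(_ x) + hx; rewrite hx lee_fin. Qed.

Lemma gauge_subadditive (R : realType) n (h : 'cV[R]_n -> \bar R) x y
    (s t : R) :
  gauge h -> h x = s%:E -> h y = t%:E ->
  exists2 r : R, h (x + y) = r%:E & r <= s + t.
Proof.
move=> gh hx hy.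
have : (h (x + y)%R <= (s + t)%:E)%E.
  have -> : x + y = (1 - 2^-1) *: (2 *: x) + 2^-1 *: (2 *: y).
    rewrite !scalerA mulVf // (_ : (1 - 2^-1) * 2 = 1 :> R) ?scale1r //.
    by field.
  have half : 0 <= (2^-1 : R) <= 1 by rlra.
  apply: (le_trans (gauge_convex gh _ _ half)).
  rewrite !(gauge_homog gh) // hx hy -!EFinM -EFinD lee_fin.
  have -> // : (1 - 2^-1) * (2 * s) + 2^-1 * (2 * t) = s + t :> R by field.
have := gauge_ge0 gh (x + y).
by case: (h (x + y)) => [r||] // _; rewrite lee_fin; exists r.
Qed.

Lemma polar_ge0 (R : realType) n (h : 'cV[R]_n -> \bar R) y :
  (0 <= polar h y)%E.
Proof.
by apply: le_ereal_inf_tmp => _ [mu [mu0 _] <-]; rewrite lee_fin ltW.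
Qed.

Lemma polar_dotv_le (R : realType) n (h : 'cV[R]_n -> \bar R) (r s : R) x y :
  (polar h y <= r%:E)%E -> h x = s%:E -> 0 <= s -> dotv x y <= r * s.
Proof.
move=> pr hx s0; have s1 : 0 < s + 1 by rlra.
apply/ler_addgt0Pr => e e0.
(* Since [s] may be zero, the slack is divided by [s + 1]; multiplied back by [s] it stays below
   [e]. *)
have e1 : 0 < e / (s + 1) by rewrite divr_gt0.
have /ereal_inf_lt[_ [mu [mu0 Hmu] <-]] : (polar h y < (r + e / (s + 1))%:E)%E.
  by rewrite (le_lt_trans pr) // lte_fin ltrDl.
rewrite lte_fin => mur.
have := Hmu x; rewrite hx -EFinM lee_fin => /le_trans; apply.
apply: (le_trans (ler_wpM2r s0 (ltW mur))).
rewrite mulrDl lerD2l mulrAC ler_pdivrMr // ler_pM2l //; rlra.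
Qed.

Lemma polar_le (R : realType) n (h : 'cV[R]_n -> \bar R) (r : R) y :
  (forall x, 0 <= h x)%E -> 0 <= r ->
  (forall x (s : R), h x = s%:E -> dotv x y <= r * s) -> (polar h y <= r%:E)%E.
Proof.
move=> h0 r0 Hr; apply/lee_addgt0Pr => e e0.
(* The infimum ranges over positive multipliers only, and positivity makes the bound trivial where
   [h] is infinite. *)
have re0 : 0 < r + e by rlra.
rewrite -EFinD; apply: ereal_inf_lbound; exists (r + e) => //; split => // x.
have := h0 x; case E : (h x) => [s||] //; last first.
  by rewrite gt0_muley ?lte_fin ?leey.
rewrite lee_fin -EFinM lee_fin => s0; apply: (le_trans (Hr _ _ E)).
by rewrite ler_wpM2r //; rlra.
Qed.

(** * Compactness and the growth of closed gauges *)

Lemma norm_coord_le (R : realType) m n (M : 'M[R]_(m, n)) i j :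
  `|M i j| <= `|M|.
Proof.
rewrite [leRHS]/Num.norm /= mx_normrE.
by rewrite (le_bigmax _ (fun ij : 'I_m * 'I_n => `|M ij.1 ij.2|) (i, j)).
Qed.

Lemma norm_matrix_le (R : realType) m n (M : 'M[R]_(m, n)) (r : R) :
  0 <= r -> (forall i j, `|M i j| <= r) -> `|M| <= r.
Proof.
move=> r0 Mr; rewrite [leLHS]/Num.norm /= mx_normrE.
by apply: bigmax_le => // ij _.
Qed.

Lemma norm_trmx (R : realType) m n (M : 'M[R]_(m, n)) : `|M^T| = `|M|.
Proof.
apply/eqP; rewrite eq_le; apply/andP; split; apply: norm_matrix_le => // i j.
  by rewrite mxE norm_coord_le.
  by have := norm_coord_le M^T j i; rewrite mxE.
Qed.

Lemma continuous_trmx (R : realType) m n :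
  continuous (@trmx R m n : 'M[R]_(m, n) -> 'M[R]_(n, m)).
Proof.
move=> M B [P MP PB]; exists (fun i j => P j i) => [i j|N NP].
  by have := MP j i; rewrite mxE.
by apply: PB => i j; rewrite mxE; exact: NP.
Qed.

Lemma continuous_dotvl (R : realType) n (y : 'cV[R]_n) :
  continuous (fun w => dotv w y).
Proof.
have -> : (fun w => dotv w y) = (fun w : 'cV_n => \sum_i w i ord0 * y i ord0).
  by apply: funext => w; exact: dotvE.
apply: continuous_big; first exact: add_continuous.
move=> i _ w; apply: continuousM; last exact: cst_continuous.
exact: coord_continuous.
Qed.

Lemma compact_rV_unit_sphere (R : realType) n :
  compact [set v : 'rV[R]_n | `|v| = 1].
Proof.
apply: bounded_closed_compact.
  exists 1; split; first exact: num_real.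
  by move=> r r1 v /= ->; exact: ltW.
have -> : [set v : 'rV[R]_n | `|v| = 1] = Num.norm @^-1` [set 1] by [].
apply: preimage_closed; last exact: closed_eq.
by move=> v _; exact: norm_continuous.
Qed.

(** Near each unit vector all large [mu] work; compactness makes [mu] uniform on the sphere, and
    homogeneity extends the bound to every [w]. *)
Lemma closed_gauge_growth (R : realType) n (rho : 'cV[R]_n -> \bar R) y
    (e : R) :
  closed_gauge rho -> 0 < e ->
  (forall w, (rho w <= 0)%E -> dotv w y <= 0) ->
  exists2 mu : R, 0 < mu &
    forall w (s : R), rho w = s%:E -> dotv w y <= mu * s + e * `|w|.
Proof.
move=> [grho lrho] e0 Hy.
pose P (k : R) (v : 'rV[R]_n) :=
  forall s : R, rho v^T = s%:E -> dotv v^T y <= k * s + e.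
have /compact_near_coveringP /(_ R +oo P _) cover :=
  @compact_rV_unit_sphere R n.
have {cover} [] : \forall k \near +oo, [set v : 'rV[R]_n | `|v| = 1] `<=` P k.
  apply: cover => v _.
  have dv : \forall v' \near v, dotv v'^T y < dotv v^T y + e.
    have /cvgr_lt := continuous_comp (@continuous_trmx R 1 n v)
      (@continuous_dotvl R n y v^T).
    by apply; rewrite ltrDl.
  (* Where [rho] vanishes, continuity of the inner product and the slack [e] suffice. Elsewhere
     [rho] stays above some [a > 0] nearby, and any [k] above [|dotv v^T y| / a] is enough. *)
  have [rv0|rv0] := leP (rho v^T) 0%E.
    near=> v' k => s rs /=.
    apply: (@le_trans _ _ (dotv v^T y + e)); first by apply: ltW; near: v'.
    rewrite lerD2r; apply: le_trans (Hy _ rv0) _; apply: mulr_ge0.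
      by near: k; apply: nbhs_pinfty_ge; exact: num_real.
    exact: gauge_ge0_fin rs.
  have [a a0 arv] : exists2 a : R, 0 < a & (a%:E < rho v^T)%E.
    move: rv0; case: (rho v^T) => [r||] //; last by exists 1; rewrite ?ltry.
    by rewrite lte_fin => r0; exists (r / 2); rewrite ?lte_fin; rlra.
  have [V vV Va] := lrho _ _ arv.
  have vV' : \forall v' \near v, V v'^T.
    exact: (@continuous_trmx R 1 n v _ vV).
  near=> v' k => s rs /=.
  have as_ : a <= s.
    have /Va : V v'^T by near: v'.
    by rewrite rs lte_fin => /ltW.
  apply: (@le_trans _ _ (dotv v^T y + e)); first by apply: ltW; near: v'.
  rewrite lerD2r; apply: (@le_trans _ _ (`|dotv v^T y| / a * a)).
    by rewrite divfK ?gt_eqF // ler_norm.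
  apply: ler_pM => //; first by rewrite divr_ge0 // ltW.
    exact: ltW.
  by near: k; apply: nbhs_pinfty_ge; exact: num_real.
move=> M [_ HM].
pose mu := Num.max (M + 1) 1.
have mu0 : 0 < mu by rewrite lt_max ltr01 orbT.
exists mu => // w s ws.
have [->|w0] := eqVneq w 0.
  by rewrite dotv0l normr0 mulr0 addr0 mulr_ge0 ?(gauge_ge0_fin grho ws) ?ltW.
have nw : 0 < `|w| by rewrite normr_gt0.
have := HM mu _ (`|w|^-1 *: w)^T _ (`|w|^-1 * s).
rewrite trmxK (gauge_homog grho) ?invr_gt0 // ws -EFinM dotvZl => H.
have {}H : `|w|^-1 * dotv w y <= mu * (`|w|^-1 * s) + e.
  apply: H => //.
    by rewrite lt_max ltrDl ltr01.
  by rewrite /= norm_trmx normrZ normfV normr_id mulVf // gt_eqF.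
rewrite -(ler_pM2l (_ : 0 < `|w|^-1)) ?invr_gt0 //.
by rewrite mulrDr (mulrCA _ e) mulVf ?gt_eqF // mulr1 (mulrCA _ mu).
Unshelve. all: by end_near. Qed.

(** * Support functions of level sets *)

Lemma gauge_levelset_polar (R : realType) n (rho : 'cV[R]_n -> \bar R) y :
  closed_gauge rho ->
  (forall w, (rho w <= 0)%E -> dotv w y <= 0) ->
  closure (edom (polar rho)) y.
Proof.
move=> crho Hy B /nbhs_ballP [e /= e0 yB].
have grho := crho.1.
have d0 : 0 < e / 2 by rewrite divr_gt0.
have [mu mu0 Hmu] := closed_gauge_growth crho d0 Hy.
(* [K] is the sum of the epigraphs of [mu * rho] and of [dotv w y + e / 2 * |w|]. The growth bound
   makes it nonnegative over the origin. *)
pose K (w : 'cV[R]_n) (t : R) := exists w1 w2 s, [/\ w = w1 + w2,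
  rho w1 = s%:E & mu * s + dotv w2 y + e / 2 * `|w2| <= t].
have [||||y' Hy'] := @cone_linear_minorant R n K.
- move=> _ t1 _ t2 [u1 [u2 [s [-> us st1]]]] [v1 [v2 [s' [-> vs st2]]]].
  have [r ruv rs] := gauge_subadditive grho us vs.
  exists (u1 + v1), (u2 + v2), r; split=> //; first by rewrite addrACA.
  rewrite dotvDl; apply: le_trans (lerD st1 st2).
  have h1 : mu * r <= mu * (s + s') by rewrite ler_pM2l.
  have h2 : e / 2 * `|u2 + v2| <= e / 2 * (`|u2| + `|v2|).
    by rewrite ler_pM2l // ler_normD.
  by rlra.
- move=> c _ t c0 [u1 [u2 [s [-> us st]]]].
  exists (c *: u1), (c *: u2), (c * s); split; first by rewrite scalerDr.
    by rewrite (gauge_homog grho) // us.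
  rewrite dotvZl normrZ gtr0_norm //.
  have : c * (mu * s + dotv u2 y + e / 2 * `|u2|) <= c * t by rewrite ler_pM2l.
  by rlra.
- move=> t [w1 [w2 [s [/esym/eqP]]]]; rewrite addrC addr_eq0 => /eqP -> ws.
  rewrite dotvNl normrN; apply: le_trans; have := Hmu _ _ ws; rlra.
- move=> w t _; exists (dotv (- w) y + e / 2 * `|- w|), 0, (- w), 0.
  by split; rewrite ?add0r ?(gauge0 grho) // mulr0 add0r.
exists y'; split.
  rewrite /edom /=; apply: (@le_lt_trans _ _ mu%:E); last exact: ltry.
  apply: polar_le; [exact: gauge_ge0|exact: ltW|move=> x s xs].
  rewrite dotvC; apply: Hy'; exists x, 0, s.
  by split; rewrite ?addr0 ?dotv0l ?normr0 ?mulr0 ?addr0.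
(* With zero gauge part, testing plus and minus a basis vector puts each coordinate of [y'] within
   [e / 2] of that of [y]. *)
have Hw w : dotv w y' <= dotv w y + e / 2 * `|w|.
  rewrite dotvC; apply: Hy'; exists 0, w, 0.
  by split; rewrite ?add0r ?(gauge0 grho) // mulr0 add0r.
apply: yB; split=> // i j; rewrite ord1 /ball /=.
have nd : `|delta_mx i ord0 : 'cV[R]_n| <= 1.
  apply: norm_matrix_le => // k l; rewrite mxE.
  by case: (_ && _); rewrite ?normr1 ?normr0.
have h1 := Hw (delta_mx i ord0); have h2 := Hw (- delta_mx i ord0).
have h3 : e / 2 * `|delta_mx i ord0 : 'cV[R]_n| <= e / 2 * 1.
  by rewrite ler_pM2l.
move: h1 h2; rewrite normrN !dotvNl !dotv_delta => h1 h2.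
by rewrite ltr_norml; apply/andP; split; lra.
Qed.

(** The zero set of [rho] is a cone inside the level set, and a linear form bounded above on a cone
    is nonpositive there. *)
Lemma gauge_levelset_dotv_le0 (R : realType) n (rho : 'cV[R]_n -> \bar R)
    (sigma s : R) y :
  gauge rho -> 0 <= sigma ->
  (forall w, (rho w <= sigma%:E)%E -> dotv w y <= s) ->
  forall w, (rho w <= 0)%E -> dotv w y <= 0.
Proof.
move=> grho sg0 Hs w w0; rewrite leNgt; apply/negP => dw.
have rw : rho w = 0%E by apply/eqP; rewrite eq_le w0 (gauge_ge0 grho).
have s0 : 0 <= s.
  by have := Hs 0; rewrite (gauge0 grho) dotv0l lee_fin; exact.
have c0 : 0 < (s + 1) / dotv w y by rewrite divr_gt0 //; rlra.
have := Hs (((s + 1) / dotv w y) *: w).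
rewrite (gauge_homog grho) // rw mule0 lee_fin dotvZl divfK ?gt_eqF //.
by move=> /(_ sg0) hs; rlra.
Qed.

(* The convention that 0 h is the indicator of cl (dom h) is exactly what
   makes this hold at sigma = 0. *)
Lemma scale_fun_polar_leP (R : realType) n (rho : 'cV[R]_n -> \bar R)
    (sigma s : R) y :
  closed_gauge rho -> 0 <= sigma ->
  (scale_fun sigma (polar rho) y <= s%:E)%E <->
  (forall w, (rho w <= sigma%:E)%E -> dotv w y <= s).
Proof.
move=> crho sg0; have grho := crho.1; split=> [|Hs].
  rewrite /scale_fun /indicator_fun; case: eqVneq => [->|sgn0].
    case: ifPn => //; rewrite inE lee_fin => cy s0 w w0.
    apply: le_trans s0; rewrite leNgt; apply/negP => dw.
    have rw : rho w = 0%E by apply/eqP; rewrite eq_le w0 (gauge_ge0 grho).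
    (* An open half-space around [y] meets [edom (polar rho)], where the polar inequality at
       [rho w = 0] contradicts positivity. *)
    have /cy[z []] : nbhs y [set z | 0 < dotv z w].
      by have /cvgr_gt := @continuous_dotvl R n w y; apply; rewrite dotvC.
    rewrite /edom /= dotvC => pz; apply/negP; rewrite -leNgt.
    have := polar_ge0 rho z; move: pz; case E : (polar rho z) => [r||] // _ r0.
    have : (polar rho z <= r%:E)%E by rewrite E.
    by move=> /polar_dotv_le/(_ rw (lexx _)); rewrite mulr0.
  have sgp : 0 < sigma by rewrite lt_neqAle eq_sym sgn0.
  have := polar_ge0 rho y; case E : (polar rho y) => [r||] //.
    rewrite lee_fin -EFinM lee_fin => r0 srs w wsg.
    have [q q0 wq] : exists2 q : R, 0 <= q & rho w = q%:E.
      by apply: gauge_finite => //; exact: le_lt_trans wsg (ltry _).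
    have pr : (polar rho y <= r%:E)%E by rewrite E.
    apply: (le_trans (polar_dotv_le pr wq q0)); apply: le_trans srs.
    by rewrite mulrC ler_wpM2r //; move: wsg; rewrite wq lee_fin.
  by rewrite gt0_muley ?lte_fin.
have s0 : 0 <= s.
  by have := Hs 0; rewrite (gauge0 grho) dotv0l lee_fin; exact.
have H0 := gauge_levelset_dotv_le0 grho sg0 Hs.
rewrite /scale_fun /indicator_fun; case: eqVneq => [_|sgn0].
  by rewrite mem_set ?lee_fin //; exact: gauge_levelset_polar.
have sgp : 0 < sigma by rewrite lt_neqAle eq_sym sgn0.
have : (polar rho y <= (s / sigma)%:E)%E.
  apply: polar_le; [exact: gauge_ge0|by rewrite divr_ge0|move=> x t xt].
  have [t0|t0] := eqVneq t 0.
    by rewrite t0 mulr0; apply: H0; rewrite xt t0.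
  have tp : 0 < t by rewrite lt_neqAle eq_sym t0 (gauge_ge0_fin grho xt).
  (* The point is rescaled onto the level [rho = sigma]; the case [t = 0], where this is impossible,
     was settled by [H0]. *)
  have := Hs ((sigma / t) *: x).
  rewrite (gauge_homog grho) ?divr_gt0 // xt -EFinM divfK // lexx.
  rewrite dotvZl mulrAC ler_pdivrMr // => /(_ isT).
  by rewrite (mulrAC s) ler_pdivlMr // mulrC (mulrC s).
have := polar_ge0 rho y; case: (polar rho y) => [r||] //.
by rewrite -EFinM !lee_fin ler_pdivlMr // mulrC.
Qed.

Lemma FdP (R : realType) n (rho : 'cV[R]_n -> \bar R) b (sigma : R) y :
  closed_gauge rho -> 0 <= sigma ->
  Fd rho b sigma y <-> forall u, Fp rho b sigma u -> 1 <= dotv u y.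
Proof.
move=> crho sg0.
have -> : Fd rho b sigma y =
    (scale_fun sigma (polar rho) y <= (dotv b y - 1)%:E)%E :> Prop.
  rewrite /Fd /=; case: (scale_fun _ _ _) => [r||] //=.
    by rewrite -EFinB !lee_fin; congr is_true; apply/idP/idP => ?; rlra.
  by rewrite addey // leey leNye.
apply: iff_trans (scale_fun_polar_leP _ _ crho sg0) _; split=> H w Hw.
  have := H _ Hw; rewrite !dotv_lin; rlra.
have := H (b - w); rewrite /Fp /= opprB addrC subrK => /(_ Hw).
by rewrite !dotv_lin; rlra.
Qed.

(** Subgradients of a support function that lie in the set are its maximizers: the inequality tested
    at [z = 0] gives one direction, and the support function dominating [dotv w] gives the other. *)
Lemma subdiff_support (R : realType) n (rho : 'cV[R]_n -> \bar R)
    (sigma : R) y w :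
  closed_gauge rho -> 0 <= sigma -> (rho w <= sigma%:E)%E ->
  subdiff (scale_fun sigma (polar rho)) y w <->
  forall v, (rho v <= sigma%:E)%E -> dotv v y <= dotv w y.
Proof.
move=> crho sg0 wsg.
have grho := crho.1.
have S_ge z : ((dotv w z)%:E <= scale_fun sigma (polar rho) z)%E.
  case E : (scale_fun sigma (polar rho) z) => [r||]; last 2 first.
  - exact: leey.
  - exfalso; have : (scale_fun sigma (polar rho) z <= (-1)%:E)%E.
      by rewrite E leNye.
    move=> /(scale_fun_polar_leP _ _ crho sg0) /(_ 0).
    by rewrite (gauge0 grho) dotv0l lee_fin => /(_ sg0); rlra.
  rewrite lee_fin.
  have : (scale_fun sigma (polar rho) z <= r%:E)%E by rewrite E.
  by move=> /(scale_fun_polar_leP _ _ crho sg0); exact.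
split=> [sub|H].
  apply/(scale_fun_polar_leP _ _ crho sg0).
  have := le_trans (sub 0) (_ : (_ <= 0%:E)%E).
  rewrite sub0r dotvNr => /(_ _).
  have S0 : (scale_fun sigma (polar rho) 0%R <= 0%:E)%E.
    by apply/(scale_fun_polar_leP _ _ crho sg0) => v _; rewrite dotv0r.
  move=> /(_ S0); case: (scale_fun _ _ _) => [r||] //; last first.
    by move=> _; exact: leNye.
  by rewrite -EFinD !lee_fin => ?; rlra.
move=> z; apply: le_trans (S_ge z); rewrite !dotv_lin.
have : (scale_fun sigma (polar rho) y <= (dotv w y)%:E)%E.
  by apply/(scale_fun_polar_leP _ _ crho sg0).
case: (scale_fun _ _ _) => [r||] //; last by move=> _; exact: leNye.
by rewrite -EFinD !lee_fin => ?; rlra.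
Qed.

(** * Relative interiors and the Lagrange multiplier *)

(** The prolonged point is an affine combination of [u0] and [u], hence in the affine hull, and it
    tends to [u0] with [e]. *)
Lemma relint_extend (R : realType) n (C : set 'cV[R]_n) u0 u :
  relint C u0 -> C u -> \forall e \near (0 : R), C (u0 + e *: (u0 - u)).
Proof.
move=> [Cu0 /nbhs0P /(near0Z (u0 - u)) Hu0] Cu.
apply: filterS Hu0 => e; apply => M [affM CM].
have := affM (- e) _ _ (CM _ Cu0) (CM _ Cu).
by rewrite opprK scalerBr scaleNr scalerDl scale1r addrA.
Qed.

Lemma near0_pos (R : realType) (P : R -> Prop) :
  (\forall e \near 0, P e) -> exists2 e, 0 < e & P e.
Proof.
move=> /nbhs_ballP[d /= d0 dP]; exists (d / 2); first by rewrite divr_gt0.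
by apply: dP; rewrite /ball /= sub0r normrN gtr0_norm ?divr_gt0 //; lra.
Qed.

Lemma econvex_le (R : realType) n (h : 'cV[R]_n -> \bar R) (t r s : R) x y :
  econvex h -> 0 <= t <= 1 -> (h x <= r%:E)%E -> (h y <= s%:E)%E ->
  (h ((1 - t) *: x + t *: y)%R <= ((1 - t) * r + t * s)%:E)%E.
Proof.
move=> ch t01 hx hy; apply: (le_trans (ch _ _ _ t01)).
move/andP: t01 => [t0 t1].
have -> : ((1 - t) * r + t * s)%:E = ((1 - t)%:E * r%:E + t%:E * s%:E)%E by [].
by rewrite leeD // lee_wpmul2l // lee_fin ?subr_ge0.
Qed.

Lemma gauge_lagrange_multiplier (R : realType) m n
    (kappa : 'cV[R]_n -> \bar R) (rho : 'cV[R]_m -> \bar R)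
    (A : 'M[R]_(m, n)) b (sigma p : R) x :
  gauge kappa -> gauge rho ->
  primal_rel_strictly_feasible kappa rho A b sigma ->
  primal_optimal kappa rho A b sigma x -> kappa x = p%:E ->
  exists y, (forall z (k : R), kappa z = k%:E -> dotv (A *m z) y <= k) /\
    (forall u, Fp rho b sigma u -> p <= dotv u y).
Proof.
move=> gk gr [x0 [/= rx0 rk0]] [_ xmin] kx.
(* Up to raising [t], this is the cone generated by the pairs [(A *m z - u, kappa z - p)]. Over the
   origin [A *m z = u], so [z] is feasible and optimality gives [p <= k]. *)
pose K (w : 'cV[R]_m) (t : R) := exists c u z k,
  [/\ 0 < c, Fp rho b sigma u, kappa z = k%:E, w = c *: (A *m z - u) &
      c * (k - p) <= t].
have [||||y Hy] := @cone_linear_minorant R m K.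
- move=> _ t1 _ t2 [c1 [u1 [z1 [k1 [c10 Fu1 kz1 -> ct1]]]]]
    [c2 [u2 [z2 [k2 [c20 Fu2 kz2 -> ct2]]]]].
  (* A sum of two generators is [c] times the generator of a convex combination with weight
     [c2 / c]. *)
  pose c := c1 + c2; have c0 : 0 < c by rewrite addr_gt0.
  have cc2 : c * (c2 / c) = c2 by rewrite mulrC divfK ?gt_eqF.
  have cc1 : c * (1 - c2 / c) = c1 by rewrite mulrBr mulr1 cc2 /c addrK.
  have t01 : 0 <= c2 / c <= 1.
    apply/andP; split; first by apply: divr_ge0; exact: ltW.
    by rewrite ler_pdivrMr // mul1r lerDr ltW.
  pose u := (1 - c2 / c) *: u1 + (c2 / c) *: u2.
  pose z := (1 - c2 / c) *: z1 + (c2 / c) *: z2.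
  have Fu : Fp rho b sigma u.
    rewrite /Fp /=; have -> : b - u =
        (1 - c2 / c) *: (b - u1) + (c2 / c) *: (b - u2).
      by rewrite !scalerBr addrACA -scalerDl subrK scale1r /u opprD.
    apply: le_trans (econvex_le (gauge_convex gr) t01 Fu1 Fu2) _.
    by rewrite -mulrDl subrK mul1r.
  have kzle : (kappa z <= ((1 - c2 / c) * k1 + (c2 / c) * k2)%:E)%E.
    by apply: econvex_le => //; [exact: gauge_convex|rewrite kz1|rewrite kz2].
  have [k k0 kz] : exists2 k : R, 0 <= k & kappa z = k%:E.
    by apply: gauge_finite => //; exact: le_lt_trans kzle (ltry _).
  exists c, u, z, k; split=> //.
    rewrite /u /z mulmxDr -!scalemxAr opprD addrACA -!scalerBr.
    by rewrite [RHS]scalerDr !scalerA cc1 cc2.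
  move: kzle; rewrite kz lee_fin -(ler_pM2l c0) mulrDr.
  rewrite (mulrA c (1 - _)) (mulrA c (c2 / c)) cc1 cc2 => ck.
  by rewrite mulrBr /c; move: ck; rewrite /c => ck; rlra.
- move=> c _ t c0 [c1 [u [z [k [c10 Fu kz -> ct]]]]].
  exists (c * c1), u, z, k; split=> //; first exact: mulr_gt0.
    by rewrite scalerA.
  by rewrite -mulrA ler_pM2l.
- move=> t [c [u [z [k [c0 Fu kz /esym/eqP]]]]].
  rewrite scaler_eq0 gt_eqF //= subr_eq0 => /eqP Azu; apply: le_trans.
  apply: mulr_ge0; first exact: ltW.
  rewrite subr_ge0 -lee_fin -kx -kz; apply: xmin.
  by split; rewrite /edom /= ?kz ?ltry // Azu.
- move=> _ t [c [u [z [k [c0 Fu kz -> ct]]]]].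
  have domz : edom kappa z by rewrite /edom /= kz ltry.
  (* Prolonging from [z] through [x0] and from [u] through [A *m x0] by the same [e] reverses the
     direction, with length factor [e]. *)
  have [e e0 [Fe ke]] := near0_pos
    (filterI (relint_extend rx0 Fu) (relint_extend rk0 domz)).
  have [k' _ kz'] := gauge_finite gk ke.
  exists (c / e * (k' - p)), (c / e), (A *m x0 + e *: (A *m x0 - u)),
    (x0 + e *: (x0 - z)), k'; split=> //; first exact: divr_gt0.
  rewrite mulmxDr -scalemxAr mulmxBr opprD addrACA subrr add0r -scalerBr.
  rewrite scalerA divfK ?gt_eqF //.
  by rewrite opprB [in RHS]addrC addrA subrK -scalerN opprB.
have {}Hy u z k : Fp rho b sigma u -> kappa z = k%:E ->
    dotv (A *m z) y - dotv u y <= k - p.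
  move=> Fu kz; rewrite -dotvNl -dotvDl dotvC; apply: Hy.
  by exists 1, u, z, k; rewrite scale1r mul1r.
exists y; split=> [z k kz|u Fu]; last first.
  by have := Hy _ _ _ Fu (gauge0 gk); rewrite mulmx0 dotv0l; rlra.
rewrite leNgt; apply/negP => kAz.
pose u0 := A *m x0; have Fu0 : Fp rho b sigma u0 := rx0.1.
have d0 : 0 < dotv (A *m z) y - k by rewrite subr_gt0.
(* Scaling [z] by this [s] makes the violation exceed the constant [dotv u0 y - p] by at least 1. *)
pose s := (`|dotv u0 y - p| + 1) / (dotv (A *m z) y - k).
have s0 : 0 < s by rewrite divr_gt0 // ltr_pwDr.
have /(Hy _ _ _ Fu0) : kappa (s *: z) = (s * k)%:E.
  by rewrite (gauge_homog gk) // kz.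
rewrite -scalemxAr dotvZl => Hs.
have sE : s * (dotv (A *m z) y - k) = `|dotv u0 y - p| + 1.
  by rewrite /s divfK ?gt_eqF.
have := ler_norm (dotv u0 y - p).
by rewrite mulrBr in sE; rlra.
Qed.

(** * Optimality conditions *)

(** Testing a subgradient at the origin reverses the polar inequality at [x]; conversely, equality
    makes [r^-1 *: v] a subgradient. *)
Lemma scale_subdiff_gauge (R : realType) n (h : 'cV[R]_n -> \bar R)
    (k r : R) x v :
  gauge h -> h x = k%:E -> polar h v = r%:E -> 0 < r ->
  scale_set (polar h v) (subdiff h x) v <-> dotv x v = k * r.
Proof.
move=> gh hx hv r0; rewrite hv.
have Hv z (q : R) : h z = q%:E -> dotv z v <= r * q.
  move=> hz; have pr : (polar h v <= r%:E)%E by rewrite hv.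
  exact: polar_dotv_le pr hz (gauge_ge0_fin gh hz).
split=> [[_ [<-] [v0 sub vE]]|xv].
  have := sub 0; rewrite hx (gauge0 gh) -EFinD lee_fin sub0r dotvNr => kv0.
  have := Hv _ _ hx; have xvE : dotv x v = r * dotv v0 x.
    by rewrite vE dotvZr dotvC.
  have : r * k <= r * dotv v0 x by rewrite ler_pM2l //; rlra.
  by move=> h1 h2; rlra.
exists r => //; exists (r^-1 *: v); last first.
  by rewrite scalerA mulfV ?gt_eqF ?scale1r.
move=> z; rewrite hx dotvZl dotvDr dotvNr !(dotvC v) xv mulrBr mulrCA.
rewrite mulVf ?gt_eqF // mulr1 -EFinD addrC subrK.
case hz : (h z) => [q||]; last 2 first.
- exact: leey.
- by have := gauge_ge0 gh z; rewrite hz.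
by rewrite lee_fin mulrC ler_pdivrMr // mulrC; exact: Hv.
Qed.

Theorem corollary3p7 (R : realType) (m n : nat)
    (kappa : 'cV[R]_n -> \bar R) (rho : 'cV[R]_m -> \bar R)
    (A : 'M[R]_(m, n)) (b : 'cV[R]_m) (sigma : R)
    (hkappa : closed_gauge kappa) (hrho : closed_gauge rho)
    (hsigma : 0 <= sigma) (hb : (sigma%:E < rho b)%E)
    (hprimal : primal_rel_strictly_feasible kappa rho A b sigma)
    (hdual : dual_rel_strictly_feasible kappa rho A b sigma)
    (ystar : 'cV[R]_m) (hystar : dual_optimal kappa rho A b sigma ystar)
    (x : 'cV[R]_n) (hx : primal_feasible kappa rho A b sigma x) :
  (primal_optimal kappa rho A b sigma x <->
    (dotv x (A^T *m ystar))%:E = (kappa x * polar kappa (A^T *m ystar))%E /\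
    subdiff (scale_fun sigma (polar rho)) ystar (b - A *m x)) /\
  (primal_optimal kappa rho A b sigma x <->
    scale_set (polar kappa (A^T *m ystar)) (subdiff kappa x) (A^T *m ystar) /\
    subdiff (scale_fun sigma (polar rho)) ystar (b - A *m x)).
Proof.
have gk := hkappa.1; have [gr sg0] := (hrho.1, hsigma).
have [[domv Fdy] ymin] := hystar; have [domx Fx] := hx.
set v := A^T *m ystar in domv ymin *.
have [k k0 kx] := gauge_finite gk domx.
have [r rv] : exists r : R, polar kappa v = r%:E.
  have := polar_ge0 kappa v; move: domv; rewrite /edom /=.
  by case: (polar kappa v) => [r||] // _ _; exists r.
have pr : (polar kappa v <= r%:E)%E by rewrite rv.
have weak z (q : R) : Fp rho b sigma (A *m z) -> kappa z = q%:E ->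
    1 <= dotv z v <= r * q.
  move=> Fz kz; apply/andP; split.
    by rewrite dotv_trmx; move/(FdP _ _ hrho sg0): Fdy; exact.
  exact: polar_dotv_le pr kz (gauge_ge0_fin gk kz).
have /andP[c1 crk] := weak _ _ Fx kx.
have rk0 : 0 < r * k by rlra.
have kp : 0 < k.
  rewrite lt_neqAle k0 andbT eq_sym; apply: contraTneq rk0 => ->.
  by rewrite mulr0 ltxx.
have rp : 0 < r by rewrite -(pmulr_lgt0 _ kp).
(* Such a [y] is dual feasible with polar value at most [q], so the optimal value [r] cannot exceed
   [q]. *)
have r_le y (q : R) : 0 <= q ->
    (forall z (s : R), kappa z = s%:E -> dotv (A *m z) y <= q * s) ->
    (forall u, Fp rho b sigma u -> 1 <= dotv u y) -> r <= q.
  move=> q0 Hq Hu.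
  have pq : (polar kappa (A^T *m y) <= q%:E)%E.
    apply: polar_le => // [|z s]; first exact: gauge_ge0.
    by rewrite dotv_trmx; exact: Hq.
  rewrite -lee_fin -rv; apply: (le_trans _ pq); apply: ymin; split.
    exact: le_lt_trans pq (ltry _).
  exact/(FdP _ _ hrho sg0).
have subP : subdiff (scale_fun sigma (polar rho)) ystar (b - A *m x) <->
    forall u, Fp rho b sigma u -> dotv x v <= dotv u ystar.
  rewrite dotv_trmx; apply: iff_trans (subdiff_support _ hrho sg0 Fx) _.
  split=> H u Hu.
    by have := H _ Hu; rewrite !dotv_lin; rlra.
  have := H (b - u); rewrite /Fp /= opprB addrC subrK => /(_ Hu).
  by rewrite !dotv_lin; rlra.
have cP : (dotv x v)%:E = (kappa x * polar kappa v)%E <-> dotv x v = k * r.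
  by rewrite kx rv -EFinM; split=> [[]|->].
have ab : primal_optimal kappa rho A b sigma x <->
    (dotv x v)%:E = (kappa x * polar kappa v)%E /\
    subdiff (scale_fun sigma (polar rho)) ystar (b - A *m x).
  split=> [xopt|[/cP xv /subP sub]].
    (* Dividing the multiplier by [k] gives a dual feasible point of value at most [k^-1], so
       [r * k <= 1] and weak duality collapses to equalities. *)
    have [y [yk yF]] := gauge_lagrange_multiplier gk gr hprimal xopt kx.
    have rk1 : r <= k^-1.
      apply: (r_le (k^-1 *: y)) => [|z s kz|u Fu]; first by rewrite invr_ge0.
        by rewrite dotvZr ler_pM2l ?invr_gt0 //; exact: yk.
      by rewrite dotvZr mulrC ler_pdivlMr // mul1r; exact: yF.
    have {}rk1 : r * k <= 1 by rewrite -ler_pdivlMr // div1r.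
    split; first by apply/cP; rlra.
    apply/subP => u Fu; apply: (@le_trans _ _ 1); first by rlra.
    by move/(FdP _ _ hrho sg0): Fdy; exact.
  have c0 : 0 < dotv x v by rlra.
  (* By [sub], [ystar] divided by [dotv x v] is still dual feasible; optimality of [ystar] forces
     [dotv x v <= 1], hence [r * k <= 1]. *)
  have rc : r <= r / dotv x v.
    apply: (r_le ((dotv x v)^-1 *: ystar)) => [|z s kz|u Fu].
    - by rewrite divr_ge0 ?ltW.
    - rewrite dotvZr mulrC mulrAC ler_pM2r ?invr_gt0 // -dotv_trmx.
      exact: polar_dotv_le pr kz (gauge_ge0_fin gk kz).
    - by rewrite dotvZr mulrC ler_pdivlMr // mul1r; exact: sub.
  move: rc; rewrite ler_pdivlMr // ger_pMr // => c_le1.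
  split=> // z [domz Fz]; have [q _ kz] := gauge_finite gk domz.
  have /andP[h1 h2] := weak _ _ Fz kz.
  by rewrite kx kz lee_fin -(ler_pM2l rp); rlra.
split=> //; apply: iff_trans ab _.
have := scale_subdiff_gauge gk kx rv rp.
tauto.
Qed.
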